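(* Let $X$ be any topological space. If $f : X \to \mathbb{R}$ is a continuous function such that $0 \le f(x) \le 1$ for all $x \in X$ and $0$ is a limit point of the range $f(X)$, then there exists an unbounded Baire one function on $X$ (that is, $B_1^*(X)$ is a proper subset of $B_1(X)$).
   Context: For a topological space $X$, $B_1(X)$ denotes the set of all Baire one functions on $X$, i.e. functions $g : X \to \mathbb{R}$ for which there is a sequence of continuous functions $g_n : X \to \mathbb{R}$ converging pointwise to $g$ on $X$. $B_1^*(X)$ denotes the set of bounded functions in $B_1(X)$. *)

(* Defs.v *)
From mathcomp Require Import all_boot all_order all_algebra.
From mathcomp Require Import all_classical all_reals all_analysis.

Set Implicit Arguments.
Unset Strict Implicit.
Unset Printing Implicit Defensive.

Import Order.TTheory GRing.Theory Num.Theory.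
Import numFieldNormedType.Exports.

Local Open Scope classical_set_scope.
Local Open Scope ring_scope.

Definition baire1 (R : realType) (X : topologicalType) : set (X -> R) :=
  [set g | exists g_ : nat -> X -> R,
     (forall n, continuous (g_ n)) /\
     (forall x, g_ n x @[n --> \oo] --> g x)].

Arguments baire1 : clear implicits.

Definition baire1_bounded (R : realType) (X : topologicalType) :
  set (X -> R) := baire1 R X `&` bounded_fun.

Arguments baire1_bounded : clear implicits.

(* Main.v *)
Require Import Defs.
From mathcomp Require Import all_boot all_order all_algebra.
From mathcomp Require Import all_classical all_reals all_analysis.

Set Implicit Arguments.
Unset Strict Implicit.
Unset Printing Implicit Defensive.

Import Order.TTheory GRing.Theory Num.Theory.
Import numFieldNormedType.Exports.

Local Open Scope classical_set_scope.
Local Open Scope ring_scope.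

(* With the convention [0^-1 = 0], the reciprocal of [f] is the pointwise limit
   of the continuous functions [f / (f^2 + 1/(n+1))], including where [f]
   vanishes. It is unbounded as soon as [f] takes arbitrarily small nonzero
   values. *)

Lemma baire1_inv (R : realType) (X : topologicalType) (f : X -> R) :
  continuous f -> baire1 R X (fun x => (f x)^-1).
Proof.
move=> f_cont; exists (fun n x => f x / (f x ^+ 2 + harmonic n)).
split=> [n x|x].
  apply: cvgM; first exact: f_cont.
  (* The positive [harmonic n] keeps the denominator nonzero even where [f] vanishes. *)
  apply: cvgV; first by rewrite gt_eqF// ltr_wpDl ?sqr_ge0 ?harmonic_gt0.
  by apply: cvgD; [apply: cvgM; exact: f_cont | exact: cvg_cst].
(* At a zero of [f] every approximant is 0, which is also the value of [0^-1]. *)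
have [->|fx0] := eqVneq (f x) 0.
  by rewrite invr0; under eq_fun do rewrite mul0r; exact: cvg_cst.
(* In this form the limit can be taken factor by factor, with [harmonic n] tending to 0. *)
rewrite [X in _ --> X](_ : _ = f x / (f x ^+ 2 + 0)); last first.
  by rewrite addr0 expr2 invfM mulVKf.
apply: cvgM; first exact: cvg_cst.
apply: cvgV; first by rewrite addr0 sqrf_eq0.
by apply: cvgD; [exact: cvg_cst | exact: cvg_harmonic].
Qed.

Lemma unbounded_inv (R : realType) (T : Type) (f : T -> R) :
  limit_point (range f) 0 -> ~ bounded_fun (fun x => (f x)^-1).
Proof.
move=> f_lim0 /pinfty_ex_gt0[M M0 fM].
have MV0 : 0 < M^-1 by rewrite invr_gt0.
(* The radius is chosen so that [f x] in the ball forces the reciprocal above [M] in absolute value.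
   This needs [f x] nonzero, hence a limit point: at a zero of [f] the reciprocal is just 0. *)
have [y [y0 [x _ fxy]]] := f_lim0 _ (nbhsx_ballx (0 : R) _ MV0).
rewrite -{y}fxy in y0 *; rewrite /ball /= sub0r normrN.
apply/negP; rewrite -leNgt.
by rewrite -lef_pV2 ?posrE ?normr_gt0// invrK -normfV; exact: fM.
Qed.

Theorem theorem3p1 (R : realType) (X : topologicalType) (f : X -> R)
    (f_cont : continuous f)
    (f_01 : forall x, 0 <= f x <= 1)
    (f_lim0 : limit_point (range f) 0) :
  (exists g : X -> R, baire1 R X g /\ ~ bounded_fun g) /\
  baire1_bounded R X `<` baire1 R X.
Proof.
have ginB : baire1 R X (fun x => (f x)^-1) by exact: baire1_inv.
have gunb := unbounded_inv f_lim0.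
split; first by exists (fun x => (f x)^-1).
(* The reverse inclusion would make the reciprocal of [f] bounded. *)
by split=> [g []//|/(_ _ ginB)[]].
Qed.
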